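(* Let $X$ be a Tychonoff space. Then the free locally convex space $L(X)$ is a Baire space if and only if $X$ is finite.
   Context: All vector spaces are over $\mathbb{R}$; all topological spaces are Tychonoff (so locally convex spaces are Hausdorff). The free locally convex space over a Tychonoff space $X$ is a locally convex space $L(X)$ together with a continuous map $i:X\to L(X)$ such that for every continuous map $f$ from $X$ to a locally convex space $E$ there is a unique continuous linear operator $\bar f:L(X)\to E$ with $f=\bar f\circ i$. *)

(* Defs.v *)
From HB Require Import structures.
From mathcomp Require Import all_boot all_order all_algebra.
From mathcomp Require Import all_classical all_reals all_analysis.

Set Implicit Arguments.
Unset Strict Implicit.
Unset Printing Implicit Defensive.

Import GRing.Theory.

Local Open Scope classical_set_scope.
Local Open Scope ring_scope.

(* For R : realType, [uniform_separatorP] shows that [completely_regular_space]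
   is the usual separation of points from closed sets by continuous functions
   into [0, 1]. *)
Definition tychonoff_space (T : topologicalType) : Prop :=
  completely_regular_space T /\ hausdorff_space T.

Definition baire_space (T : topologicalType) : Prop :=
  forall U : (set T)^nat,
    (forall n, open (U n) /\ dense (U n)) -> dense (\bigcap_n U n).

(* [tvsType R] is the type of locally convex (not necessarily Hausdorff)
   topological vector spaces, so the Hausdorff condition is stated separately.
   Since functional extensionality holds, [exists!] on the underlying function
   is uniqueness of the continuous linear operator. *)
Definition free_lcs (R : realType) (X : topologicalType) (L : tvsType R)
    (i : X -> L) : Prop :=
  [/\ hausdorff_space L, continuous i &
    forall (E : tvsType R) (f : X -> E), hausdorff_space E -> continuous f ->
      exists! g : L -> E, [/\ linear g, continuous g & f = g \o i]].

(* Main.v *)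
Require Import Defs.
From HB Require Import structures.
From mathcomp Require Import all_boot all_order all_algebra.
From mathcomp Require Import all_classical all_reals all_analysis lra.

(** A finite Hausdorff space [X] is discrete, so the coordinate map sending a
    point to the corresponding basis vector of R^n is continuous and extends to
    a continuous linear map from [L] to R^n.  The obvious linear map back is a
    two-sided inverse: on one side because of the uniqueness clause of the
    universal property, on the other by computing coordinates.  Hence [L] is
    homeomorphic to R^n, which is Baire because it is complete
    ([finite_free_lcs_baire]).

    If [X] is infinite, it contains infinitely many disjoint nonempty open
    sets, hence carries bump functions [h n] with disjoint supports.  At each
    point at most one of them is nonzero, so the values
    [h n x / (n + 1)] are the coefficients of a polynomial; for the sup norm on
    coefficients it depends continuously on [x], thanks to the factors
    [1 / (n + 1)].  The universal property extends this to a continuous linear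
    map [g] from [L] to a space of polynomials, that is, of finitely supported
    sequences.  The vectors whose image has degree below [n] form a proper
    closed subspace of [L], and these countably many subspaces cover [L]
    ([infinite_free_lcs_not_baire]).  Working with polynomials as the target
    makes it immediate that every image is finitely supported; otherwise one
    would first have to show that [L] is spanned by the image of [X]. *)

Set Implicit Arguments.
Unset Strict Implicit.
Unset Printing Implicit Defensive.

Import Order.TTheory GRing.Theory Num.Theory numFieldNormedType.Exports.

Local Open Scope classical_set_scope.
Local Open Scope ring_scope.

(** * The space of polynomials with the sup norm of coefficients *)

(** The normed space c_00 of finitely supported sequences.  The alias carries
    the topology, leaving the ring of polynomials without one. *)
Definition sup_poly (R : realType) : Type := {poly R}.

Section sup_poly_norm.
Context {R : realType}.
Implicit Types p q : {poly R}.

Definition coef_sup p : R := \big[Num.max/0]_(i < size p) `|p`_i|.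

Lemma coef_sup_ge0 p : 0 <= coef_sup p.
Proof. exact: bigmax_ge_id. Qed.

Lemma coef_le_sup p n : `|p`_n| <= coef_sup p.
Proof.
have [np|pn] := ltnP n (size p); first exact: (le_bigmax _ _ (Ordinal np)).
by rewrite nth_default// normr0 coef_sup_ge0.
Qed.

Lemma coef_sup_leP p (M : R) :
  0 <= M -> (forall n, `|p`_n| <= M) -> coef_sup p <= M.
Proof. by move=> M0 pM; apply: bigmax_le. Qed.

Lemma coef_supD p q : coef_sup (p + q) <= coef_sup p + coef_sup q.
Proof.
apply: coef_sup_leP => [|n]; first by rewrite addr_ge0 ?coef_sup_ge0.
by rewrite coefD (le_trans (ler_normD _ _))// lerD ?coef_le_sup.
Qed.

Lemma coef_supZ (a : R) p : coef_sup (a *: p) = `|a| * coef_sup p.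
Proof.
have le_supZ b q : coef_sup (b *: q) <= `|b| * coef_sup q.
  apply: coef_sup_leP => [|n]; first by rewrite mulr_ge0 ?coef_sup_ge0.
  by rewrite coefZ normrM ler_wpM2l ?coef_le_sup.
apply/le_anti; rewrite le_supZ /=.
have [->|a0] := eqVneq a 0; first by rewrite normr0 mul0r coef_sup_ge0.
rewrite -ler_pdivlMl ?normr_gt0// -normfV -[p in leLHS]scale1r.
by rewrite -(mulVf a0) -scalerA le_supZ.
Qed.

Lemma coef_sup_eq0 p : coef_sup p = 0 -> p = 0.
Proof.
move=> p0; apply/polyP => n; rewrite coef0; apply/eqP.
by have := coef_le_sup p n; rewrite p0 normr_le0.
Qed.

HB.instance Definition _ := GRing.Lmodule.copy (sup_poly R) {poly R}.
HB.instance Definition _ :=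
  Lmodule_isNormed.Build R (sup_poly R) coef_supD coef_supZ coef_sup_eq0.

Lemma continuous_coef n : continuous (fun p : sup_poly R => (p : {poly R})`_n).
Proof.
move=> p; apply/(@cvgrPdist_lt _ R^o _ _ (@nbhs_filter (sup_poly R) p)) => e e0.
apply: filterS (@nbhs_ball_norm _ (sup_poly R) p (PosNum e0)) => q /=.
by rewrite -coefB; apply: le_lt_trans (coef_le_sup _ _).
Qed.

End sup_poly_norm.

(** * Disjoint open sets and bump functions on infinite spaces *)

(** Separate two points of [W].  Either the neighbourhood of one of them is
    infinite and can serve as the second set, or it is finite, and then this
    point is isolated and may be removed from [W]. *)
Lemma infinite_open_split (T : topologicalType) (W : set T) :
  hausdorff_space T -> open W -> infinite_set W ->
  exists UV : set T * set T, [/\ open UV.1, UV.1 !=set0 & UV.1 `<=` W] /\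
    [/\ open UV.2, infinite_set UV.2, UV.2 `<=` W & UV.1 `&` UV.2 = set0].
Proof.
move=> hT oW iW; have [x Wx] := infinite_setN0 iW.
have [y [Wy yx]] : exists y, W y /\ y != x.
  have /infinite_setN0[y [Wy /eqP yx]] : infinite_set (W `\` [set x]).
    by apply: infinite_setD => //; exact: finite_set1.
  by exists y.
have := hT; rewrite open_hausdorff => /(_ _ _ yx)[[A B]]/=.
move=> -[/set_mem Ay /set_mem Bx] [oA oB /eqP AB0].
(* [x] is the point that is isolated when its neighbourhood [B] is finite *)
have [fB|iB] := pselect (finite_set (W `&` B)); last first.
  exists (W `&` A, W `&` B); split; split => //=; try exact: openI.
  - by exists y.
  - by rewrite setIACA AB0 setI0.
have /accessible_finite_set_closed cl := hausdorff_accessible hT.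
exists ([set x], W `\` [set x]); split; split => /=.
- rewrite (_ : [set x] = (W `&` B) `\` ((W `&` B) `\` [set x])).
    apply: openI; first exact: openI.
    by apply: closed_openC; apply: cl; exact: finite_setD.
  apply/seteqP; split => [_ -> /=|z [WBz /not_andP[//|/contrapT//]]].
  by split=> // -[_]; exact.
- by exists x.
- by move=> _ ->.
- by apply: openI => //; apply: closed_openC; apply: cl; exact: finite_set1.
- by apply: infinite_setD => //; exact: finite_set1.
- exact: subDsetl.
- by rewrite setIDA setIC -setIDA setDv setI0.
Qed.

(** Split off one open set at a time, keeping an infinite open remainder
    [W n] from which all later sets are taken. *)
Lemma infinite_disjoint_opens (T : topologicalType) :
  hausdorff_space T -> infinite_set [set: T] ->
  exists U : nat -> set T, [/\ forall n, open (U n),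
    forall n, U n !=set0 & trivIset [set: nat] U].
Proof.
move=> hT iT.
pose P (W : set T) := open W /\ infinite_set W.
have /choice[s sP] : forall W, exists UV : set T * set T, P W ->
   [/\ open UV.1, UV.1 !=set0 & UV.1 `<=` W] /\
    [/\ open UV.2, infinite_set UV.2, UV.2 `<=` W & UV.1 `&` UV.2 = set0].
  move=> W; have [[oW iW]|nP] := pselect (P W); last by exists (set0, set0).
  by have [UV ?] := infinite_open_split hT oW iW; exists UV.
pose W n := iter n (fun W => (s W).2) setT.
have PW n : P (W n).
  elim: n => [|n IH]; first by split => //; exact: openT.
  by have [_ []] := sP _ IH.
have Wle m n : (m <= n)%N -> W n `<=` W m.
  elim: n => [|n IH]; first by rewrite leqn0 => /eqP ->.
  rewrite leq_eqVlt => /predU1P[-> //|/IH]; apply: subset_trans.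
  by have [_ []] := sP _ (PW n).
exists (fun n => (s (W n)).1); split.
- by move=> n; have [[]] := sP _ (PW n).
- by move=> n; have [[]] := sP _ (PW n).
- apply: ltn_trivIset => m n mn; apply/seteqP; split => // z [Unz Umz].
  have [[_ _ /(_ _ Umz) Wz] _] := sP _ (PW m).
  have [_ [_ _ _ <-]] := sP _ (PW n).
  by split => //; exact: (Wle n.+1 m).
Qed.

Lemma infinite_bumps (R : realType) (T : topologicalType) :
  tychonoff_space T -> infinite_set [set: T] ->
  exists h : nat -> T -> R, [/\ forall n, continuous (h n),
    forall n x, 0 <= h n x <= 1, forall n, exists x, h n x = 1 &
    forall m n x, h m x != 0 -> h n x != 0 -> m = n].
Proof.
move=> [crT hT] iT; have [U [oU U0 tU]] := infinite_disjoint_opens hT iT.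
have /choice[h hP] : forall n, exists f : T -> R, [/\ continuous f,
    forall x, 0 <= f x <= 1, exists x, f x = 1 & forall x, f x != 0 -> U n x].
  move=> n; have [x Ux] := U0 n.
  have : uniform_separator [set x] (~` U n).
    by apply: crT => //; exact: open_closedC.
  move=> /(@uniform_separatorP _ R)[f [cf f01 f0 f1]].
  exists (fun z => 1 - f z); split.
  - by move=> z; apply: cvgB; [exact: cvg_cst|exact: cf].
  - move=> z; have /f01 : range f (f z) by exists z.
    by rewrite /= in_itv/= subr_ge0 => /andP[? ->]; rewrite lerBlDr lerDl.
  - by exists x; rewrite (f0 (f x)) ?subr0//; exists x.
  - move=> z fz; apply: contrapT => nUz; move: fz.
    by rewrite (f1 (f z)) ?subrr ?eqxx//; exists z.
exists h; split.
- by move=> n; have [] := hP n.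
- by move=> n; have [] := hP n.
- by move=> n; have [] := hP n.
- move=> m n x hm hn; have [_ _ _ /(_ _ hm) Um] := hP m.
  by have [_ _ _ /(_ _ hn) Un] := hP n; apply: tU => //; exists x.
Qed.

(** The map is the sum of the [(h n x / (n + 1)) X^n].  Near a point, finitely
    many coefficients are controlled by continuity of the [h n], and all the
    others by the factor [1 / (n + 1)]. *)
Lemma infinite_poly_map (R : realType) (T : topologicalType) :
  tychonoff_space T -> infinite_set [set: T] ->
  exists2 f : T -> sup_poly R, continuous f &
    forall n, exists x, (f x : {poly R})`_n != 0.
Proof.
move=> tT iT; have [h [ch h01 h1 hd]] := infinite_bumps R tT iT.
have /choice[f fE] : forall x, exists p : {poly R},
    forall n, p`_n = h n x / n.+1%:R.
  move=> x; have [[m hm]|h0] := pselect (exists m, h m x != 0).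
    exists ((h m x / m.+1%:R) *: 'X^m) => n; rewrite coefZ coefXn.
    have [->|nm] := eqVneq n m; first by rewrite mulr1.
    rewrite mulr0; have [->|hn] := eqVneq (h n x) 0; first by rewrite mul0r.
    by move: nm; rewrite (hd _ _ _ hn hm) eqxx.
  exists 0 => n; rewrite coef0; have [->|hn] := eqVneq (h n x) 0.
    by rewrite mul0r.
  by case: h0; exists n.
exists f => [x|n]; last first.
  have [x hx] := h1 n; exists x.
  by rewrite fE hx mul1r invr_eq0 pnatr_eq0.
apply/(@cvgrPdist_le _ (sup_poly R)) => e e0.
have [N Ne] : exists N, N.+1%:R^-1 < e :> R.
  by have [N] := ltr_add_invr e0; rewrite add0r; exists N.
have nearN : \forall y \near x, forall n : 'I_N, `|h n x - h n y| <= e.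
  by apply: filter_forall => n; apply: (cvgr_dist_le _ _ (ch n x)).
near=> y; apply: coef_sup_leP => [|n]; first exact: ltW.
rewrite coefB !fE -mulrBl normrM [`|_^-1|]ger0_norm ?invr_ge0//.
have [nN|Nn] := ltnP n N.
  rewrite (le_trans (ler_piMr _ _)) ?normr_ge0 ?invf_le1 ?ler1n ?ltr0n//.
  have : forall n : 'I_N, `|h n x - h n y| <= e by near: y.
  by move/(_ (Ordinal nN)).
rewrite (le_trans (ler_piMl _ _)) ?invr_ge0//.
  have /andP[? ?] := h01 n x; have /andP[? ?] := h01 n y.
  by rewrite ler_distl; apply/andP; split; lra.
by rewrite (le_trans _ (ltW Ne))// lef_pV2 ?posrE ?ltr0n// ler_nat.
Unshelve. all: by end_near. Qed.

(** * The infinite case *)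

Lemma tvs_cvgZr (R : realType) (L : tvsType R) (T : Type) (F : set_system T)
    (k : T -> R^o) (a : R^o) (u : L) : Filter F ->
  k x @[x --> F] --> a -> k x *: u @[x --> F] --> a *: u.
Proof.
move=> FF ka; apply: (@continuous2_cvg _ _ _ _ F _ k (fun=> u)
  (fun (b : R^o) (v : L) => b *: v)) => //; last exact: cvg_cst.
exact: (@scale_continuous R L (a, u)).
Qed.

(** The complement is a subspace that misses [u], so any [v] in it is a limit of
    vectors [t *: u + v], with [t] nonzero, lying outside it. *)
Lemma dense_coef_neq0 (R : realType) (L : tvsType R) (g : L -> sup_poly R) n :
  linear g -> (exists u, (g u : {poly R})`_n != 0) ->
  dense [set v | exists2 m, (n <= m)%N & (g v : {poly R})`_m != 0].
Proof.
move=> lg [u gu] O [v Ov] oO.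
have [gv|gv] := eqVneq ((g v : {poly R})`_n) 0; last first.
  by exists v; split => //; exists n.
have cvu : (fun t : R^o => t *: u + v) t @[t --> (0 : R^o)^'] --> v.
  apply: cvg_within_filter.
  suff : (fun t : R^o => t *: u + v) t @[t --> (0 : R^o)] --> 0 *: u + v.
    by rewrite scale0r add0r.
  apply: (@continuous2_cvg _ _ _ _ _ _ (fun t : R^o => t *: u) (fun=> v)
    (fun a b : L => a + b)).
  - exact: (@add_continuous L (_, _)).
  - by apply: tvs_cvgZr; exact: cvg_id.
  - exact: cvg_cst.
have : \forall t \near (0 : R^o)^', O (t *: u + v).
  by apply: cvu; exact: open_nbhs_nbhs.
move=> /(filterI (nbhs_dnbhs_neq _))/filter_ex[t [t0 Ot]].
exists (t *: u + v); split => //; exists n => //.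
by rewrite lg coefD coefZ gv addr0 mulf_neq0.
Qed.

Lemma infinite_free_lcs_not_baire (R : realType) (X : topologicalType)
    (L : tvsType R) (i : X -> L) :
  tychonoff_space X -> free_lcs i -> infinite_set [set: X] -> ~ baire_space L.
Proof.
move=> tX [_ _ univ] iX bL.
have [f cf f0] := infinite_poly_map R tX iX.
have [g [[lg cg fg] _]] := univ _ f (@norm_hausdorff _ (sup_poly R)) cf.
pose U n := [set v | exists2 m, (n <= m)%N & (g v : {poly R})`_m != 0].
have /bL/(_ setT) : forall n, open (U n) /\ dense (U n).
  move=> n; split; last first.
    apply: dense_coef_neq0 => //; have [x fx] := f0 n.
    by exists (i x); rewrite -[g (i x)]/((g \o i) x) -fg.
  rewrite (_ : U n = \bigcup_(m in [set m | (n <= m)%N])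
      ((fun v => (g v : {poly R})`_m) @^-1` [set~ 0])); last first.
    by apply/seteqP; split => v [m nm gm]; exists m => //; exact/eqP.
  apply: bigcup_open => m _; apply: open_comp; last first.
    exact/closed_openC/accessible_closed_set1/hausdorff_accessible/Rhausdorff.
  move=> v _; apply: (@cvg_comp _ (sup_poly R) _ g
    (fun p : sup_poly R => (p : {poly R})`_m) _ (nbhs (g v))).
    exact: cg.
  exact: continuous_coef.
case; [by exists 0|exact: openT|].
(* the coefficients of [g v] vanish from the index [size (g v)] on *)
move=> v [_ /(_ (size (g v : {poly R})) I)[m]].
by move=> /(nth_default 0) -> /eqP.
Qed.

(** * The finite case *)

Lemma homeomorphic_baire (S T : topologicalType) (g : S -> T) (h : T -> S) :
  continuous g -> continuous h -> cancel g h -> cancel h g ->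
  baire_space T -> baire_space S.
Proof.
move=> cg ch gK hK bT U oU O [x Ox] oO.
have [|||t [Ot Ut]] := bT (fun n => h @^-1` U n) _ (h @^-1` O).
- move=> n; have [oUn dUn] := oU n; split; first exact: open_comp.
  move=> V [t Vt] oV; have [||s [Vs Us]] := dUn (g @^-1` V).
  + by exists (h t); rewrite /= hK.
  + exact: open_comp.
  by exists (g s); split => //=; rewrite gK.
- by exists (g x); rewrite /= gK.
- exact: open_comp.
by exists (h t).
Qed.

Lemma finite_hausdorff_continuous (S T : topologicalType) (f : S -> T) :
  hausdorff_space S -> finite_set [set: S] -> continuous f.
Proof.
move=> hS fS x A /nbhs_singleton Afx.
have /accessible_finite_set_closed cl := hausdorff_accessible hS.
have ox : open [set x].
  rewrite -[[set x]]setCK; apply: closed_openC; apply: cl.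
  exact: sub_finite_set fS.
by apply: filterS (open_nbhs_nbhs (conj ox (erefl x))) => _ ->.
Qed.

HB.instance Definition _ (R : realType) (m n : nat) :=
  Complete.on (matrix R m n).

(** With the points of [X] listed as [t j], the coordinate map [g] and the
    combination map [h] identify [L] with the row vectors indexed by [X]. *)
Lemma finite_free_lcs_baire (R : realType) (X : topologicalType)
    (L : tvsType R) (i : X -> L) :
  hausdorff_space X -> free_lcs i -> finite_set [set: X] -> baire_space L.
Proof.
move=> hX [hL ci univ] fX; have /finite_seqP[s0 s0E] := fX.
pose s := undup s0; pose n := size s; pose t := tnth (in_tuple s).
have us : uniq s by exact: undup_uniq.
have ts x : exists j, x = t j.
  apply/tnthP; rewrite mem_undup.
  by have : [set: X] x by []; rewrite s0E.
have tI (j k : 'I_n) : (t j == t k) = (j == k).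
  exact/inj_eq/tuple_uniqP.
pose f x : 'rV[R]_n := \row_j (x == t j)%:R.
have cf : continuous f by exact: finite_hausdorff_continuous.
have [g [[lg cg fg] _]] := univ _ f (@norm_hausdorff _ 'rV[R]_n) cf.
have gi x : g (i x) = f x by rewrite fg.
pose h (a : 'rV[R]_n) : L := \sum_j a 0 j *: i (t j).
have lh : linear h.
  move=> c a b; rewrite /h scaler_sumr -big_split /=; apply: eq_bigr => j _.
  by rewrite !mxE scalerDl scalerA.
have ch : continuous h.
  move=> a; apply: (@cvg_big _ _ _ _ _ (@add_continuous L) _ _ _ _ _
    (nbhs_filter a)) => j _.
  by apply: tvs_cvgZr; exact: coord_continuous.
have hf x : h (f x) = i x.
  have [j ->] := ts x; rewrite /h (bigD1 j)//= big1 => [|k kj].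
    by rewrite addr0 mxE eqxx scale1r.
  by rewrite mxE tI eq_sym (negbTE kj) scale0r.
(* [h \o g] and the identity both extend [i], hence coincide *)
have gK : cancel g h.
  have [k [_ kE]] := univ _ i hL ci.
  have hgE : k = h \o g.
    apply: kE; split.
    - by move=> c u v; rewrite /= lg lh.
    - by move=> v; apply: continuous_comp; [exact: cg|exact: ch].
    - by apply/funext => x; rewrite /= gi hf.
  have idE : k = id by apply: kE; split => // v; exact: cvg_id.
  by move=> v; rewrite -[LHS]/((h \o g) v) -hgE idE.
have hK : cancel h g.
  move=> a; pose G := GRing.isLinear.Build R L 'rV[R]_n *:%R g lg.
  pose g' : {linear L -> 'rV[R]_n} := HB.pack g G.
  have gZ b u : g (b *: u) = b *: g u := linearZ_LR g' b u.
  rewrite -[LHS]/(g' (h a)) linear_sum; apply/rowP => k.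
  rewrite summxE (bigD1 k)//= big1 => [|j jk].
    by rewrite gZ gi !mxE eqxx mulr1 addr0.
  by rewrite gZ gi !mxE tI (negbTE jk) mulr0.
apply: (homeomorphic_baire cg ch gK hK) => U oU.
exact: (@Baire R 'rV[R]_n U oU).
Qed.

Theorem corollary5p5 (R : realType) (X : topologicalType) (L : tvsType R)
    (i : X -> L) (hX : tychonoff_space X) (hL : free_lcs i) :
  baire_space L <-> finite_set [set: X].
Proof.
split => [bL|]; last by case: hX => _ hX; exact: finite_free_lcs_baire hL.
by apply: contrapT => iX; exact: (infinite_free_lcs_not_baire hX hL).
Qed.
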